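(* Let $p$ be an odd prime, let $\alpha\ge 1$ be an integer, let $\lambda\in\mathbb{Z}_p$ with $\lambda\neq 0$, let $q\in\mathbb{C}_p$ with $|1-q|_p<p^{-1/(p-1)}$, and let $x\in\mathbb{C}_p$. For every integer $m\ge 0$, $$\lambda^m E_m^{(\alpha)}\left(\frac{x}{\lambda}\right)=\sum_{n=0}^m q^{m-n}Bl_{n,q}^{(\alpha)}(x|\lambda)\,S_2(m,n)$$ and $$Bl_{m,q}^{(\alpha)}(x|\lambda)=\sum_{\ell=0}^m S_1(m,\ell)\,q^{m-\ell}\lambda^\ell E_\ell^{(\alpha)}\left(\frac{x}{\lambda}\right).$$
   Context: $\mathbb{Z}_p$ is the ring of $p$-adic integers and $\mathbb{C}_p$ is the completion of an algebraic closure of $\mathbb{Q}_p$, with norm normalized by $|p|_p=1/p$. For a continuous function $f$ on $\mathbb{Z}_p$ (with values in $\mathbb{C}_p$), the fermionic $p$-adic integral is $$\int_{\mathbb{Z}_p} f(y)\,d\mu_{-1}(y)=\lim_{N\to\infty}\sum_{y=0}^{p^N-1}f(y)(-1)^y;$$ multiple integrals are iterated. The $q$-product is $(z)_{n,q}=z(z-q)(z-2q)\cdots(z-(n-1)q)$ for $n\ge 0$, with $(z)_{0,q}=1$, and $(z)_n=(z)_{n,1}$ is the falling factorial. The $q$-Boole polynomials of the first kind with order $\alpha$ are $$Bl_{n,q}^{(\alpha)}(x|\lambda)=\int_{\mathbb{Z}_p}\cdots\int_{\mathbb{Z}_p}(\lambda x_1+\cdots+\lambda x_\alpha+x)_{n,q}\,d\mu_{-1}(x_1)\cdots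 d\mu_{-1}(x_\alpha)\quad(n\ge 0).$$ The (signed) Stirling numbers of the first kind $S_1(n,\ell)$ and the Stirling numbers of the second kind $S_2(n,\ell)$ are defined by $(z)_n=\sum_{\ell=0}^n S_1(n,\ell)z^\ell$ and $z^n=\sum_{\ell=0}^n S_2(n,\ell)(z)_\ell$. The Euler polynomials of order $\alpha$, $E_n^{(\alpha)}(z)$, are defined by $\left(\frac{2}{e^t+1}\right)^\alpha e^{zt}=\sum_{n=0}^\infty E_n^{(\alpha)}(z)\frac{t^n}{n!}$. *)

(* Defs.v *)
From HB Require Import structures.
From mathcomp Require Import all_boot all_order all_algebra.
From mathcomp Require Import all_classical all_reals all_analysis.
Set Implicit Arguments.
Unset Strict Implicit.
Unset Printing Implicit Defensive.
Import Order.TTheory GRing.Theory Num.Theory numFieldNormedType.Exports.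
Local Open Scope classical_set_scope.
Local Open Scope ring_scope.

(* A p-adic norm cannot be declared as a MathComp norm: the axiom
   normrMn, `|x *+ n| = `|x| *+ n, fails for it.  Absolute values are therefore
   plain functions to R. *)
Record is_ultrametric_abs (R : realType) (K : fieldType) (v : K -> R) : Prop :=
  IsUltrametricAbs {
    uabs_ge0 : forall x, 0 <= v x;
    uabs_eq0 : forall x, v x = 0 <-> x = 0;
    uabsM : forall x y, v (x * y) = v x * v y;
    uabsD : forall x y, v (x + y) <= Num.max (v x) (v y)
  }.

Definition abs_cvg (R : realType) (K : fieldType) (v : K -> R)
    (u : nat -> K) (l : K) : Prop :=
  v (u n - l) @[n --> \oo] --> (0 : R).

Definition abs_cauchy (R : realType) (K : fieldType) (v : K -> R)
    (u : nat -> K) : Prop :=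
  forall e : R, 0 < e ->
    exists N : nat, forall m n : nat, (N <= m)%N -> (N <= n)%N ->
      v (u m - u n) < e.

Record is_completion (R : realType) (F K : fieldType) (vF : F -> R) (vK : K -> R)
    (iota : F -> K) : Prop := IsCompletion {
  completion_isometry : forall x, vK (iota x) = vF x;
  completion_dense : forall (y : K) (e : R), 0 < e ->
    exists x : F, vK (y - iota x) < e;
  completion_complete : forall u : nat -> K, abs_cauchy vK u ->
    exists l : K, abs_cvg vK u l
}.

(* logn p 0 = 0, so the case x = 0 has to be treated apart. *)
Definition padic_abs (R : realType) (p : nat) (x : rat) : R :=
  if x == 0 then 0
  else p%:R ^+ logn p `|denq x|%N / p%:R ^+ logn p `|numq x|%N.

(* C_p together with the tower Q -> Q_p -> (algebraic closure of Q_p) -> C_p.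
   These data are unique up to isometric isomorphism. *)
Record padic_complex (R : realType) (p : nat) := PadicComplex {
  Qp : fieldType;
  Qp_abs : Qp -> R;
  Qp_of_rat : {rmorphism rat -> Qp};
  Qp_absP : is_ultrametric_abs Qp_abs;
  Qp_completion : is_completion (@padic_abs R p) Qp_abs Qp_of_rat;

  Qpbar : closedFieldType;
  Qpbar_abs : Qpbar -> R;
  Qpbar_of_Qp : {rmorphism Qp -> Qpbar};
  Qpbar_absP : is_ultrametric_abs Qpbar_abs;
  Qpbar_isometry : forall x, Qpbar_abs (Qpbar_of_Qp x) = Qp_abs x;
  Qpbar_algebraic : forall y, algebraicOver Qpbar_of_Qp y;

  Cp :> fieldType;
  Cp_abs : Cp -> R;
  Cp_of_Qpbar : {rmorphism Qpbar -> Cp};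
  Cp_absP : is_ultrametric_abs Cp_abs;
  Cp_completion : is_completion Qpbar_abs Cp_abs Cp_of_Qpbar
}.

Definition padic_int_pred (R : realType) (p : nat) (C : padic_complex R p)
  : {pred Qp C} := fun x => Qp_abs x <= 1.

Lemma padic_int_subring (R : realType) (p : nat) (C : padic_complex R p) :
  subring_closed (@padic_int_pred R p C).
Proof.
case: (Qp_absP C) => ge0 eq0 absM absD.
have abs1 : Qp_abs (1 : Qp C) = 1.
  have n0 : Qp_abs (1 : Qp C) != 0.
    by apply/eqP => /eq0 /eqP; rewrite oner_eq0.
  by apply: (mulfI n0); rewrite -absM !mulr1.
have absN1 : Qp_abs (-1 : Qp C) = 1.
  have := absM (-1 : Qp C) (-1); rewrite mulrNN mulr1 abs1 => /esym/eqP.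
  by rewrite -expr2 sqrp_eq1 // => /eqP.
have absN x : Qp_abs (- x : Qp C) = Qp_abs x by rewrite -mulN1r absM absN1 mul1r.
split=> [|x y|x y]; rewrite /padic_int_pred !unfold_in ?abs1 // => hx hy.
  by apply: le_trans (absD _ _) _; rewrite absN ge_max hx hy.
by rewrite absM mulr_ile1.
Qed.

HB.instance Definition _ (R : realType) (p : nat) (C : padic_complex R p) :=
  GRing.isSubringClosed.Build (Qp C) (@padic_int_pred R p C)
    (@padic_int_subring R p C).

Record padic_int (R : realType) (p : nat) (C : padic_complex R p) := PadicInt {
  padic_int_val : Qp C;
  padic_int_valP : padic_int_val \in @padic_int_pred R p C
}.

HB.instance Definition _ (R : realType) (p : nat) (C : padic_complex R p) :=
  [isSub of padic_int C for @padic_int_val R p C].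
HB.instance Definition _ (R : realType) (p : nat) (C : padic_complex R p) :=
  [Choice of padic_int C by <:].
HB.instance Definition _ (R : realType) (p : nat) (C : padic_complex R p) :=
  [SubChoice_isSubComNzRing of padic_int C by <:].

Definition Cp_of_Zp (R : realType) (p : nat) (C : padic_complex R p)
    (y : padic_int C) : C :=
  Cp_of_Qpbar C (Qpbar_of_Qp C (\val y)).

(* Total: the value is 0 if the limit does not exist. *)
Definition fermionic_integral (R : realType) (p : nat) (C : padic_complex R p)
    (f : padic_int C -> C) : C :=
  xget 0 [set l | abs_cvg (@Cp_abs R p C)
                    (fun N => \sum_(0 <= y < p ^ N) f y%:R * (-1) ^+ y) l].

(* The first entry of the tuple is the innermost integration variable. *)
Fixpoint iterated_fermionic_integral (R : realType) (p : nat)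
    (C : padic_complex R p) (a : nat) : (a.-tuple (padic_int C) -> C) -> C :=
  match a with
  | 0 => fun f => f [tuple]
  | a'.+1 => fun f => iterated_fermionic_integral
      (fun s : a'.-tuple (padic_int C) =>
         fermionic_integral (fun y => f [tuple of y :: s]))
  end.

Definition qprod (K : pzRingType) (q z : K) (n : nat) : K :=
  \prod_(i < n) (z - i%:R * q).

Definition qBoole (R : realType) (p : nat) (C : padic_complex R p)
    (a n : nat) (q : C) (lambda : padic_int C) (x : C) : C :=
  iterated_fermionic_integral (fun s : a.-tuple (padic_int C) =>
    qprod q (\sum_(i < a) Cp_of_Zp lambda * Cp_of_Zp (tnth s i) + x) n).

Definition falling_poly (n : nat) : {poly int} := qprod 1 'X n.

Definition stirling1 (n l : nat) : int := (falling_poly n)`_l.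

Definition stirling2_spec (n : nat) : set (nat -> int) :=
  [set s : nat -> int | 'X^n = \sum_(l < n.+1) s l *: falling_poly l
           /\ forall l, (n < l)%N -> s l = 0].

Definition stirling2 (n l : nat) : int := xget (fun=> 0) (stirling2_spec n) l.

Lemma falling_polyS n : falling_poly n.+1 = falling_poly n * ('X - n%:R).
Proof. by rewrite /falling_poly /qprod big_ord_recr /= mulr1. Qed.

Lemma falling_polyE n : falling_poly n = \prod_(i < n) ('X - (i%:R)%:P).
Proof. by apply: eq_bigr => i _; rewrite mulr1 polyC_natr. Qed.

Lemma falling_poly_monic n : falling_poly n \is monic.
Proof. by rewrite falling_polyE monic_prod_XsubC. Qed.

Lemma size_falling_poly n : size (falling_poly n) = n.+1.
Proof. by rewrite falling_polyE size_prod_XsubC -[index_enum _]enumT size_enum_ord. Qed.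

Lemma stirling1P n :
  falling_poly n = \sum_(l < n.+1) stirling1 n l *: 'X^l.
Proof. by rewrite -poly_def -size_falling_poly -[LHS]coefK. Qed.

Lemma stirling2P n : stirling2_spec n (stirling2 n).
Proof.
rewrite /stirling2; apply: xgetPex.
elim: n => [|n [s [sE s0]]].
  exists (fun l => (l == 0)%:R); split=> [|[|l]//].
  by rewrite big_ord1 /falling_poly /qprod big_ord0 scale1r.
exists (fun l => (if l is k.+1 then s k else 0) + l%:R * s l); split; last first.
  by case=> // l nl; rewrite s0 // s0 ?mulr0 ?addr0 // ltnW.
under eq_bigr do rewrite scalerDl.
rewrite big_split /= [X in _ + X]big_ord_recr /= s0 // mulr0 scale0r addr0.
rewrite big_ord_recl /= scale0r add0r -big_split exprSr sE mulr_suml.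
apply: eq_bigr => l _ /=; rewrite falling_polyS -scalerAl -scalerA.
rewrite scaler_nat mulrBr scalerBr -addrA -[LHS]addr0; congr (_ + _).
by rewrite mulr_natr scalerMnr addrC subrr.
Qed.

Lemma stirling2_unique (n : nat) (s t : nat -> int) :
  stirling2_spec n s -> stirling2_spec n t -> s = t.
Proof.
move=> [sE s0] [tE t0]; apply/funext => l.
have [ln|/[dup] nl /s0 ->] := leqP l n; last by rewrite t0.
have free (d : nat -> int) k :
    \sum_(l < k) d l *: falling_poly l = 0 -> forall l, (l < k)%N -> d l = 0.
  elim: k => [//|k IHk]; rewrite big_ord_recr /= => dE.
  have dk : d k = 0.
    move/(congr1 (fun r : {poly int} => r`_k)): dE; rewrite coef0 coefD coefZ.
    have -> : (falling_poly k)`_k = 1.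
      by have /monicP := falling_poly_monic k; rewrite lead_coefE size_falling_poly.
    rewrite mulr1 nth_default ?add0r //.
    apply: leq_trans (size_sum _ _ _) _; apply/bigmax_leqP => i _.
    by apply: leq_trans (size_scale_leq _ _) _; rewrite size_falling_poly.
  move: dE; rewrite dk scale0r addr0 => /IHk{}IHk i.
  by rewrite ltnS leq_eqVlt => /predU1P[->//|/IHk].
apply/eqP; rewrite -subr_eq0; apply/eqP.
apply: (free (fun l => s l - t l) n.+1) => //.
under eq_bigr do rewrite scalerBl.
by rewrite sumrB -sE -tE subrr.
Qed.

(* Formal power series, given by their sequences of coefficients. *)
Definition fps_mul (K : pzSemiRingType) (f g : nat -> K) (n : nat) : K :=
  \sum_(i < n.+1) f i * g (n - i)%N.

Definition fps_const (K : pzSemiRingType) (c : K) (n : nat) : K :=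
  if n == 0 then c else 0.

Definition fps_add (K : pzSemiRingType) (f g : nat -> K) (n : nat) : K :=
  f n + g n.

Definition fps_pow (K : pzSemiRingType) (f : nat -> K) (a : nat) : nat -> K :=
  iter a (fps_mul f) (fps_const 1).

Definition fps_exp (K : fieldType) (c : K) (n : nat) : K := c ^+ n / n`!%:R.

(* [:: g n; ...; g 0] for g the inverse of f, from
   f 0 * g n.+1 + \sum_(k < n.+1) f k.+1 * g (n - k) = 0. *)
Fixpoint fps_inv_seq (K : fieldType) (f : nat -> K) (n : nat) : seq K :=
  if n is m.+1 then
    let s := fps_inv_seq f m in
    (- (f 0)^-1 * \sum_(k < m.+1) f k.+1 * s`_k) :: s
  else [:: (f 0)^-1].

Definition fps_inv (K : fieldType) (f : nat -> K) (n : nat) : K :=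
  (fps_inv_seq f n)`_0.

Lemma fps_mulV (K : fieldType) (f : nat -> K) :
  f 0 != 0 -> fps_mul f (fps_inv f) =1 fps_const 1.
Proof.
move=> f0.
have nthE n k : (k <= n)%N -> (fps_inv_seq f n)`_k = fps_inv f (n - k).
  elim: n k => [|n IHn] [|k] //= kn.
  by rewrite IHn // subSS.
case=> [|n]; first by rewrite /fps_mul big_ord1 /fps_inv /= divff.
rewrite /fps_mul big_ord_recl /= subn0 {1}/fps_inv /= mulrA mulrN divff //.
rewrite mulN1r addrC; apply/eqP; rewrite subr_eq0; apply/eqP.
apply: eq_bigr => k _; rewrite subSS nthE //.
exact: (ltn_ord k).
Qed.

(* E_n^(a)(z) = n! [t^n] (2 / (e^t + 1))^a e^(zt). *)
Definition Euler_poly (K : fieldType) (a n : nat) (z : K) : K :=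
  let g := fps_mul (fps_const 2)
                   (fps_inv (fps_add (fps_exp 1) (fps_const 1))) in
  n`!%:R * fps_mul (fps_pow g a) (fps_exp z) n.

(* Main.v *)
Require Import Defs.
From mathcomp Require Import all_boot all_order all_algebra.
From mathcomp Require Import all_classical all_reals all_analysis.
From mathcomp Require Import ring.
Import Order.TTheory GRing.Theory Num.Theory numFieldNormedType.Exports.
Set Implicit Arguments.
Unset Strict Implicit.
Unset Printing Implicit Defensive.
Local Open Scope classical_set_scope.
Local Open Scope ring_scope.

(** The fermionic integral inverts a difference operator: if
    F (y + 1) + F y = 2 f y, then the alternating sum of f over 0 <= y < p^N
    telescopes to (F 0 + F (p^N)) / 2, because p^N is odd, and p^N tends to 0
    p-adically; so the integral of f exists and equals F 0 as soon as F is
    continuous at 0 ([fermionic_integral_primitive]).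

    The Euler polynomials are made for this.  Multiplying their generating
    function by e^t + 1 gives
    E_n^(a+1)(z+1) + E_n^(a+1)(z) = 2 E_n^(a)(z) ([Euler_poly_shift]), whence the
    integral of E_n^(a)(y + z) in y is E_n^(a+1)(z).  Since E_n^(0)(z) = z^n,
    integrating z^l with z = x/lambda + x_1 + ... + x_alpha over all the x_i
    yields E_l^(alpha)(x/lambda).

    The integrand of the q-Boole polynomial is a combination of such powers: the
    expansion of the falling factorial into powers, made homogeneous in q and z,
    reads (z)_{n,q} = sum_l S_1(n,l) q^(n-l) z^l ([qprod_stirling1]).  This
    gives the second identity ([qBoole_stirling1]); the first one follows from
    it because the Stirling matrices are inverse to each other
    ([stirling2_stirling1]). *)

(** * Formal power series and the Euler polynomials *)

(** Reduces identities between Cauchy products to the ring of polynomials. *)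
Lemma fps_mulE (K : comNzRingType) (f g : nat -> K) (N n : nat) : (n < N)%N ->
  fps_mul f g n = ((\poly_(i < N) f i) * (\poly_(i < N) g i))`_n.
Proof.
move=> nN; rewrite coefM; apply: eq_bigr => -[i /= lin] _.
rewrite !coef_poly (leq_ltn_trans _ nN) //.
by rewrite (leq_ltn_trans (leq_subr _ _) nN).
Qed.

Lemma fps_mulC (K : comNzRingType) (f g : nat -> K) : fps_mul f g = fps_mul g f.
Proof. by apply/funext => n; rewrite !(@fps_mulE _ _ _ n.+1)// mulrC. Qed.

Lemma fps_mulA (K : comNzRingType) (f g h : nat -> K) :
  fps_mul f (fps_mul g h) = fps_mul (fps_mul f g) h.
Proof.
suff E (u v w : nat -> K) n : fps_mul u (fps_mul v w) n =
    ((\poly_(i < n.+1) u i) * ((\poly_(i < n.+1) v i) * \poly_(i < n.+1) w i))`_n.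
  by apply/funext => n; rewrite [fps_mul (fps_mul f g) h]fps_mulC !E mulrA mulrC.
rewrite coefM; apply: eq_bigr => -[i /= lin] _.
by rewrite coef_poly lin -fps_mulE // ltnS leq_subr.
Qed.

Lemma fps_const_mul (K : comNzRingType) (c : K) (f : nat -> K) n :
  fps_mul (fps_const c) f n = c * f n.
Proof.
rewrite /fps_mul big_ord_recl subn0 big1 ?addr0 // => i _.
by rewrite /fps_const /= mul0r.
Qed.

Lemma fps_mulDr (K : comNzRingType) (f g h : nat -> K) n :
  fps_mul f (fps_add g h) n = fps_mul f g n + fps_mul f h n.
Proof. by rewrite /fps_mul -big_split; apply: eq_bigr => i _; rewrite mulrDr. Qed.

(** The binomial theorem, divided by n!. *)
Lemma fps_expD (K : fieldType) (a b : K) : (forall n, n`!%:R != 0 :> K) ->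
  fps_exp (a + b) = fps_mul (fps_exp a) (fps_exp b).
Proof.
move=> fact_neq0; apply/funext => n.
rewrite /fps_exp /fps_mul addrC exprDn mulr_suml.
apply: eq_bigr => -[i /=]; rewrite ltnS => lin _.
have <- : 'C(n, i)%:R * (i`!%:R * (n - i)`!%:R) = n`!%:R :> K.
  by rewrite -!natrM bin_fact.
rewrite -[_ *+ 'C(n, i)]mulr_natr.
have bin_neq0 : 'C(n, i)%:R != 0 :> K.
  apply: contra (fact_neq0 n) => /eqP b0.
  by rewrite -(bin_fact lin) natrM b0 mul0r.
have := fact_neq0 i; have := fact_neq0 (n - i)%N; move: bin_neq0.
set u := _%:R => u0; set v := _%:R => v0; set w := _%:R => w0.
by field; rewrite u0 v0 w0.
Qed.

Lemma Euler_poly0 (K : fieldType) n (z : K) : n`!%:R != 0 :> K ->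
  Euler_poly 0 n z = z ^+ n.
Proof.
by move=> n0; rewrite /Euler_poly /= fps_const_mul mul1r mulrC mulfVK.
Qed.

(** The generating function gains a factor 2 / (e^t + 1) from one order to the
    next, and its values at z + 1 and z add up to the one at z times e^t + 1. *)
Lemma Euler_poly_shift (K : fieldType) a n (z : K) :
  (forall n, n`!%:R != 0 :> K) ->
  Euler_poly a.+1 n (z + 1) + Euler_poly a.+1 n z = 2 * Euler_poly a n z.
Proof.
move=> fact_neq0; have two_neq0 : 2 != 0 :> K := fact_neq0 2.
rewrite /Euler_poly /= -mulrDr mulrCA; congr (_ * _).
set d := fps_add _ _; set g := fps_mul (fps_const 2) _; set ga := fps_pow g a.
have dg : fps_mul d g = fps_const 2.
  rewrite [g]fps_mulC fps_mulA (_ : fps_mul d _ = fps_const 1).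
    by apply/funext => k; rewrite fps_const_mul mul1r.
  apply/funext/fps_mulV.
  by rewrite /d /fps_add /fps_exp /fps_const expr0 fact0 divr1.
rewrite -fps_const_mul fps_expD //.
have split_d : fps_mul (fps_exp z) d =
    fps_add (fps_mul (fps_exp z) (fps_exp 1)) (fps_exp z).
  apply/funext => k; rewrite fps_mulDr /fps_add; congr (_ + _).
  by rewrite fps_mulC fps_const_mul mul1r.
by rewrite -fps_mulDr -split_d [fps_mul (fps_exp z) d]fps_mulC fps_mulA
  [fps_mul (fps_mul g ga) d]fps_mulC fps_mulA dg -fps_mulA.
Qed.

(** * Stirling numbers *)

(** For invertible q this is the expansion of q^n (z/q)_n into powers of z/q;
    both sides being homogeneous of degree n in q and z, it holds for all q. *)
Lemma qprod_stirling1 (A : comNzRingType) (q z : A) n :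
  qprod q z n =
    \sum_(l < n.+1) (stirling1 n l)%:~R * q ^+ (n - l) * z ^+ l.
Proof.
elim: n => [|n IHn].
  rewrite /qprod big_ord0 big_ord1 /stirling1 /falling_poly /qprod big_ord0.
  by rewrite coef1 !mulr1.
have stirling1S l : stirling1 n.+1 l =
    (if l is k.+1 then stirling1 n k else 0) - n%:R * stirling1 n l.
  rewrite /stirling1 falling_polyS mulrBr coefB coefMX mulr_natr coefMn.
  by rewrite mulr_natl; case: l.
have top : stirling1 n n.+1 = 0.
  by rewrite /stirling1 nth_default // size_falling_poly.
rewrite {1}/qprod big_ord_recr /= -/(qprod q z n) IHn mulrBr.
under [RHS]eq_bigr do rewrite stirling1S intrB !mulrBl.
rewrite sumrB [X in _ = X - _]big_ord_recl [X in X - _ = _]mulr_suml /=.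
rewrite !mul0r add0r; congr (_ - _).
  by apply: eq_bigr => l _; rewrite /bump /= subSS exprSr mulrA.
rewrite [RHS]big_ord_recr /= top mulr0 !mul0r addr0 mulr_suml.
apply: eq_bigr => l _; rewrite subSn ?exprS; last by rewrite -ltnS.
by rewrite intrM pmulrn; ring.
Qed.

(** Compares the coefficients of X^l in the expansion of X^m along the falling
    factorials. *)
Lemma stirling2_stirling1 m l :
  \sum_(n < m.+1) stirling2 m n * stirling1 n l = (l == m)%:R.
Proof.
case: (stirling2P m) => /(congr1 (fun P : {poly int} => P`_l)) + _.
rewrite coefXn coef_sum => ->.
by apply: eq_bigr => n _; rewrite coefZ.
Qed.

(** * Limits for an ultrametric absolute value *)

Section UltrametricLimits.
Context (R : realType) (K : fieldType) (v : K -> R).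
Context (vP : is_ultrametric_abs v).

Let v_ge0 := uabs_ge0 vP.
Let vM := uabsM vP.
Let v0 : v 0 = 0. Proof. exact/(uabs_eq0 vP). Qed.

Lemma uabs1 : v 1 = 1.
Proof.
have n0 : v 1 != 0 by apply/eqP => /(uabs_eq0 vP)/eqP; rewrite oner_eq0.
by apply: (mulfI n0); rewrite -vM !mulr1.
Qed.

Lemma uabsN x : v (- x) = v x.
Proof.
rewrite -mulN1r vM; suff -> : v (-1) = 1 by rewrite mul1r.
have := vM (-1) (-1); rewrite mulrNN mulr1 uabs1 => /esym/eqP.
by rewrite -expr2 sqrp_eq1 // => /eqP.
Qed.

Lemma uabsX x n : v (x ^+ n) = v x ^+ n.
Proof. by elim: n => [|n IH]; rewrite ?uabs1 // !exprS vM IH. Qed.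

Lemma uabs_triangle x y : v (x + y) <= v x + v y.
Proof.
by apply: le_trans (uabsD vP _ _) _; rewrite ge_max lerDl lerDr !v_ge0.
Qed.

Lemma abs_cvg_cst a : abs_cvg v (fun=> a) a.
Proof. by rewrite /abs_cvg subrr v0; exact: cvg_cst. Qed.

Lemma abs_cvg_le u l (w : nat -> R) :
  (forall n, v (u n - l) <= w n) -> w n @[n --> \oo] --> (0 : R) -> abs_cvg v u l.
Proof.
move=> uw w0; apply: (squeeze_cvgr _ (@cvg_cst _ (0 : R) _ _ _) w0).
by apply: nearW => n; rewrite v_ge0 uw.
Qed.

Lemma abs_cvgD u w a b : abs_cvg v u a -> abs_cvg v w b ->
  abs_cvg v (fun n => u n + w n) (a + b).
Proof.
move=> ua wb; apply: (@abs_cvg_le _ _ (fun n => v (u n - a) + v (w n - b))).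
  by move=> n; rewrite opprD addrACA uabs_triangle.
by rewrite -[0 in X in _ --> X]addr0; exact: cvgD.
Qed.

Lemma abs_cvgM u w a b : abs_cvg v u a -> abs_cvg v w b ->
  abs_cvg v (fun n => u n * w n) (a * b).
Proof.
move=> ua wb; apply: (@abs_cvg_le _ _ (fun n => v (u n - a) * v (w n - b) +
    (v a * v (w n - b) + v (u n - a) * v b))).
  move=> n; rewrite -!vM.
  (* Expanding around the limits leaves only the constant factors a and b next
     to the differences that tend to 0. *)
  have -> : u n * w n - a * b =
      (u n - a) * (w n - b) + (a * (w n - b) + (u n - a) * b) by ring.
  by rewrite (le_trans (uabs_triangle _ _)) // lerD2l uabs_triangle.
rewrite [0 in X in _ --> X](_ : _ = 0 * 0 + (v a * 0 + 0 * v b)); last by ring.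
apply: cvgD; first exact: cvgM.
by apply: cvgD; apply: cvgM => //; exact: cvg_cst.
Qed.

Lemma abs_cvgX u a k : abs_cvg v u a -> abs_cvg v (fun n => u n ^+ k) (a ^+ k).
Proof.
move=> ua; elim: k => [|k IH]; first exact: abs_cvg_cst.
under [X in abs_cvg v X]eq_fun do rewrite exprS.
by rewrite exprS; exact: abs_cvgM.
Qed.

Lemma abs_cvg_sum k (u : nat -> nat -> K) (a : nat -> K) :
  (forall i, abs_cvg v (u i) (a i)) ->
  abs_cvg v (fun n => \sum_(i < k) u i n) (\sum_(i < k) a i).
Proof.
move=> ua; elim: k => [|k IH].
  by under [X in abs_cvg v X]eq_fun do rewrite big_ord0;
     rewrite big_ord0; exact: abs_cvg_cst.
under [X in abs_cvg v X]eq_fun do rewrite big_ord_recr.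
by rewrite big_ord_recr; exact: abs_cvgD.
Qed.

Lemma abs_cvg_unique u a b : abs_cvg v u a -> abs_cvg v u b -> a = b.
Proof.
move=> ua ub; apply/eqP; rewrite -subr_eq0; apply/eqP/(uabs_eq0 vP).
have : abs_cvg v (fun=> a) b.
  apply: (@abs_cvg_le _ _ (fun n => v (u n - a) + v (u n - b))).
    move=> n; rewrite -[v (u n - a)]uabsN.
    have -> : a - b = - (u n - a) + (u n - b) by ring.
    exact: uabs_triangle.
  by rewrite -[0 in X in _ --> X]addr0; exact: cvgD.
move=> ab; apply: (cvg_unique (@norm_hausdorff R R) _ ab).
exact: (@cvg_cst R^o).
Qed.

Lemma Euler_poly_cvg a n u z : abs_cvg v u z ->
  abs_cvg v (fun N => Euler_poly a n (u N)) (Euler_poly a n z).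
Proof.
move=> uz; apply: abs_cvgM; first exact: abs_cvg_cst.
apply: (@abs_cvg_sum n.+1
  (fun i N => _ i * fps_exp (u N) (n - i)) (fun i => _ i * fps_exp z (n - i))).
move=> i; apply: abs_cvgM; first exact: abs_cvg_cst.
by apply: abs_cvgM; [exact: abs_cvgX | exact: abs_cvg_cst].
Qed.

End UltrametricLimits.

(** * Fermionic integrals *)

Section PadicComplex.
Context (R : realType) (p : nat) (C : padic_complex R p).

Lemma Cp_nat_neq0 n : (0 < n)%N -> n%:R != 0 :> C.
Proof.
move=> n0; rewrite -(rmorph_nat (Cp_of_Qpbar C)) fmorph_eq0.
rewrite -(rmorph_nat (Qpbar_of_Qp C)) fmorph_eq0.
by rewrite -(rmorph_nat (Qp_of_rat C)) fmorph_eq0 pnatr_eq0 -lt0n.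
Qed.

Lemma Cp_fact_neq0 n : n`!%:R != 0 :> C.
Proof. exact/Cp_nat_neq0/fact_gt0. Qed.

Lemma Cp_abs_nat n : Cp_abs (n%:R : C) = padic_abs R p n%:R.
Proof.
rewrite -(rmorph_nat (Cp_of_Qpbar C)) (completion_isometry (Cp_completion C)).
rewrite -(rmorph_nat (Qpbar_of_Qp C)) Qpbar_isometry.
by rewrite -(rmorph_nat (Qp_of_rat C)) (completion_isometry (Qp_completion C)).
Qed.

Lemma Cp_abs_p : prime p -> Cp_abs (p%:R : C) = p%:R^-1.
Proof.
move=> pp; rewrite Cp_abs_nat /padic_abs pnatr_eq0 -[_ == _]/(p == 0)%N.
rewrite eqn0Ngt prime_gt0 //= -[p%:R : rat]/(p%:Z%:~R) numq_int denq_int.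
rewrite logn1 expr0 div1r.
by rewrite logn_prime // eqxx expr1.
Qed.

Lemma expn_p_cvg0 : prime p -> abs_cvg (@Cp_abs R p C) (fun N => (p ^ N)%:R) 0.
Proof.
move=> pp; rewrite /abs_cvg.
under eq_fun do rewrite subr0 natrX (uabsX (Cp_absP C)) Cp_abs_p //.
apply: cvg_expr; rewrite normfV ger0_norm ?ler0n //.
by rewrite invf_lt1 ?ltr1n ?ltr0n ?prime_gt0 ?prime_gt1.
Qed.

Lemma Cp_of_Zp_nat n : Cp_of_Zp (n%:R : padic_int C) = n%:R.
Proof. by rewrite /Cp_of_Zp !rmorph_nat. Qed.

Lemma Cp_of_Zp_neq0 (y : padic_int C) : y != 0 -> Cp_of_Zp y != 0.
Proof.
move=> y0; rewrite /Cp_of_Zp !fmorph_eq0.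
by apply: contra y0 => /eqP y0; apply/eqP/val_inj; rewrite y0 rmorph0.
Qed.

Lemma fermionic_integral_eq (f : padic_int C -> C) l :
  abs_cvg (@Cp_abs R p C) (fun N => \sum_(0 <= y < p ^ N) f y%:R * (-1) ^+ y) l ->
  fermionic_integral f = l.
Proof.
move=> fl; apply: (abs_cvg_unique (Cp_absP C) _ fl).
exact: (xgetPex 0 (ex_intro _ l fl)).
Qed.

(** The functional equation makes the alternating sums telescope into
    (F 0 - (-1)^n F n) / 2, and for n = p^N the sign is -1 and F n tends to
    F 0. *)
Lemma fermionic_integral_primitive (f : padic_int C -> C) (F : C -> C) :
  prime p -> odd p ->
  (forall y : nat, F (y%:R + 1) + F y%:R = 2 * f y%:R) ->
  (forall u : nat -> C, abs_cvg (@Cp_abs R p C) u 0 ->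
     abs_cvg (@Cp_abs R p C) (F \o u) (F 0)) ->
  fermionic_integral f = F 0.
Proof.
move=> pp op FE Fcont; apply: fermionic_integral_eq.
have two0 : 2 != 0 :> C by exact: Cp_nat_neq0.
have sumE n : \sum_(0 <= y < n) f y%:R * (-1) ^+ y =
    2^-1 * (F 0 - (-1) ^+ n * F n%:R).
  apply: (mulfI two0); rewrite mulrA divff // mul1r.
  elim: n => [|n IH]; first by rewrite big_nil mulr0 mul1r subrr.
  rewrite big_nat_recr //= mulrDr IH mulrA -FE exprS -natr1; ring.
suff : abs_cvg (@Cp_abs R p C)
    (fun N => 2^-1 * (F 0 + F (p ^ N)%:R)) (2^-1 * (F 0 + F 0)).
  rewrite -mulr2n -[F 0 *+ 2]mulr_natl mulKf //; congr abs_cvg; apply/funext => N.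
  by rewrite sumE -signr_odd oddX op orbT expr1 mulN1r opprK.
apply: (abs_cvgM (Cp_absP C)); first exact: (abs_cvg_cst (Cp_absP C)).
apply: (abs_cvgD (Cp_absP C)); first exact: (abs_cvg_cst (Cp_absP C)).
exact/Fcont/expn_p_cvg0.
Qed.

(** One integration raises the order by one.  Linear combinations are built into
    the statement, as the integral is additive only on functions for which the
    limit exists. *)
Lemma fermionic_integral_Euler b n (c : nat -> C) z : prime p -> odd p ->
  fermionic_integral (fun y : padic_int C =>
    \sum_(l < n) c l * Euler_poly b l (Cp_of_Zp y + z)) =
  \sum_(l < n) c l * Euler_poly b.+1 l z.
Proof.
move=> pp op.
pose F t := \sum_(l < n) c l * Euler_poly b.+1 l (t + z).
rewrite (@fermionic_integral_primitive _ F) // => [|y|u u0].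
- by rewrite /F; under eq_bigr do rewrite add0r.
- rewrite /F -big_split /= mulr_sumr; apply: eq_bigr => l _.
  rewrite Cp_of_Zp_nat -mulrDr addrAC Euler_poly_shift; first by rewrite mulrCA.
  exact: Cp_fact_neq0.
- apply: (@abs_cvg_sum _ _ _ (Cp_absP C) n
    (fun l N => c l * Euler_poly b.+1 l (u N + z))
    (fun l => c l * Euler_poly b.+1 l (0 + z))) => l.
  apply: (abs_cvgM (Cp_absP C)); first exact: (abs_cvg_cst (Cp_absP C)).
  apply: (Euler_poly_cvg (Cp_absP C)).
  by apply: (abs_cvgD (Cp_absP C)) => //; exact: (abs_cvg_cst (Cp_absP C)).
Qed.

(** The order b is free so that the innermost integration, which raises it, can
    be absorbed by the induction on the number a of variables. *)
Lemma iterated_fermionic_integral_Euler a b n (c : nat -> C) z :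
  prime p -> odd p ->
  iterated_fermionic_integral (fun s : a.-tuple (padic_int C) =>
    \sum_(l < n) c l * Euler_poly b l (\sum_(i < a) Cp_of_Zp (tnth s i) + z)) =
  \sum_(l < n) c l * Euler_poly (b + a) l z.
Proof.
move=> pp op; elim: a b => [|a IHa] b /=.
  by under eq_bigr do rewrite big_ord0 add0r; rewrite addn0.
rewrite addnS -addSn -IHa; congr iterated_fermionic_integral; apply/funext => s.
rewrite -fermionic_integral_Euler //; congr fermionic_integral; apply/funext => y.
apply: eq_bigr => l _; rewrite big_ord_recl tnth0 -addrA.
by under eq_bigr do rewrite tnthS.
Qed.

(** Factoring out lambda from the integrand leaves the powers of
    x_1 + ... + x_a + x/lambda, that is, Euler polynomials of order 0. *)
Lemma qBoole_stirling1 a m (q : C) (lambda : padic_int C) (x : C) :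
  prime p -> odd p -> lambda != 0 ->
  qBoole a m q lambda x =
    \sum_(l < m.+1) (stirling1 m l)%:~R * q ^+ (m - l)
        * Cp_of_Zp lambda ^+ l * Euler_poly a l (x / Cp_of_Zp lambda).
Proof.
move=> pp op /Cp_of_Zp_neq0 l0.
rewrite -[a in RHS]add0n -(@iterated_fermionic_integral_Euler a 0 m.+1
  (fun l => (stirling1 m l)%:~R * q ^+ (m - l) * Cp_of_Zp lambda ^+ l)) //.
congr iterated_fermionic_integral; apply/funext => s.
rewrite qprod_stirling1; apply: eq_bigr => l _.
rewrite Euler_poly0 ?Cp_fact_neq0 // -[RHS]mulrA -exprMn mulrDr mulr_sumr.
by rewrite [_ * (x / _)]mulrC divfK.
Qed.

End PadicComplex.

Theorem theorem2p4 (R : realType) (p : nat) (C : padic_complex R p)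
    (p_prime : prime p) (p_odd : odd p)
    (alpha : nat) (alpha_ge1 : (1 <= alpha)%N)
    (lambda : padic_int C) (lambda_neq0 : lambda != 0)
    (q : C) (q_near1 : Cp_abs (1 - q) < p%:R `^ (- (p.-1)%:R^-1))
    (x : C) (m : nat) :
  Cp_of_Zp lambda ^+ m * Euler_poly alpha m (x / Cp_of_Zp lambda) =
    \sum_(0 <= n < m.+1)
      q ^+ (m - n) * qBoole alpha n q lambda x * (stirling2 m n)%:~R
  /\
  qBoole alpha m q lambda x =
    \sum_(0 <= l < m.+1)
      (stirling1 m l)%:~R * q ^+ (m - l)
        * Cp_of_Zp lambda ^+ l * Euler_poly alpha l (x / Cp_of_Zp lambda).
Proof.
rewrite !big_mkord; split; last exact: qBoole_stirling1.
pose e l := Cp_of_Zp lambda ^+ l * Euler_poly alpha l (x / Cp_of_Zp lambda).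
transitivity (\sum_(n < m.+1) \sum_(l < m.+1)
    (stirling2 m n * stirling1 n l)%:~R * (q ^+ (m - l) * e l)).
  rewrite exchange_big /=.
  under eq_bigr do rewrite -mulr_suml -rmorph_sum stirling2_stirling1.
  rewrite (bigD1 ord_max) //= big1 => [|l lm].
    by rewrite eqxx subnn expr0 !mul1r addr0.
  by rewrite -[_ == m]/(l == ord_max) (negPf lm) mul0r.
apply: eq_bigr => -[n /= nm] _; rewrite qBoole_stirling1 //.
rewrite (big_ord_widen _ (fun l => (stirling1 n l)%:~R * q ^+ (n - l)
  * Cp_of_Zp lambda ^+ l * Euler_poly alpha l (x / Cp_of_Zp lambda)) nm).
rewrite mulrAC mulr_sumr [RHS]big_mkcond; apply: eq_bigr => l _.
(* S_1(n, l) = 0 for n < l <= m, so the inner sum may run up to m. *)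
case: ifP => ln; last first.
  rewrite /stirling1 nth_default ?size_falling_poly 1?leqNgt ?ln //.
  by rewrite mulr0 mul0r.
have -> : (m - l = (m - n) + (n - l))%N by rewrite addnBA ?subnK.
by rewrite intrM exprD /e; ring.
Qed.
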